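(* Addition is first-order definable in the structure $\langle\mathbb{Z},\cdot,\leqslant\rangle$. Explicitly, for all $x,y,z\in\mathbb{Z}$, $$x+y=z \iff \big[z=0\wedge \mathsf{S}(x)\cdot\mathsf{S}(y)=\mathsf{S}(x\cdot y)\big]\;\vee\;\big[z\neq 0\wedge \mathsf{S}(z\cdot x)\cdot\mathsf{S}(z\cdot y)=\mathsf{S}(z\cdot z\cdot\mathsf{S}(x\cdot y))\big],$$ where the right-hand side is a formula over $\langle\mathbb{Z},\cdot,\leqslant\rangle$, the successor function $\mathsf{S}$ being definable from the order by $\mathsf{S}(u)=v\iff\forall w\,[u<w\leftrightarrow v\leqslant w]$.
   Context: $\langle\mathbb{Z},\cdot,\leqslant\rangle$ is the first-order structure whose domain is the set of integers, with the usual multiplication and the usual (non-strict) order. ''Addition is definable'' means that the ternary relation $\{(x,y,z)\in\mathbb{Z}^3 : x+y=z\}$ is defined by a first-order formula (without parameters) in the language $\{\cdot,\leqslant\}$. $\mathsf{S}(u)$ denotes the successor $u+1$ of the integer $u$, and $u<v$ abbreviates $u\leqslant v\wedge u\neq v$. *)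

(* Defs.v *)
From HB Require Import structures.
From mathcomp Require Import all_boot all_order all_algebra.

Set Implicit Arguments.
Unset Strict Implicit.
Unset Printing Implicit Defensive.

Import Order.TTheory GRing.Theory Num.Theory.

Local Open Scope ring_scope.

(* Terms and formulas of the first-order language with equality whose only
   non-logical symbols are a binary function symbol (Mul) and a binary relation
   symbol (Le).  There are no constant symbols, hence no parameters.
   [formula n] is the type of formulas whose free variables are among n de
   Bruijn variables; a quantifier binds variable 0 and shifts the others. *)
Inductive term (n : nat) : Type :=
  | Var of 'I_n
  | Mul of term n & term n.

Inductive formula : nat -> Type :=
  | Eq n : term n -> term n -> formula n
  | Le n : term n -> term n -> formula n
  | Not n : formula n -> formula n
  | And n : formula n -> formula n -> formula n
  | Or n : formula n -> formula n -> formula n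
  | Imp n : formula n -> formula n -> formula n
  | All n : formula n.+1 -> formula n
  | Ex n : formula n.+1 -> formula n.

Record structure := Structure {
  dom : Type;
  mul_in : dom -> dom -> dom;
  le_in : dom -> dom -> Prop
}.

Fixpoint eval (M : structure) (n : nat) (v : n.-tuple (dom M)) (t : term n)
  : dom M :=
  match t with
  | Var i => tnth v i
  | Mul t1 t2 => mul_in (eval v t1) (eval v t2)
  end.

Fixpoint sat (M : structure) (n : nat) (phi : formula n)
  : n.-tuple (dom M) -> Prop :=
  match phi in formula n return n.-tuple (dom M) -> Prop with
  | Eq _ t u => fun v => eval v t = eval v u
  | Le _ t u => fun v => le_in (eval v t) (eval v u)
  | Not _ p => fun v => ~ sat p v
  | And _ p q => fun v => sat p v /\ sat q v
  | Or _ p q => fun v => sat p v \/ sat q v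
  | Imp _ p q => fun v => sat p v -> sat q v
  | All _ p => fun v => forall a : dom M, sat p [tuple of a :: v]
  | Ex _ p => fun v => exists a : dom M, sat p [tuple of a :: v]
  end.

Definition defines2 (M : structure) (phi : formula 2)
    (R : dom M -> dom M -> Prop) : Prop :=
  forall x y : dom M, sat phi [tuple x; y] <-> R x y.

Definition defines3 (M : structure) (phi : formula 3)
    (R : dom M -> dom M -> dom M -> Prop) : Prop :=
  forall x y z : dom M, sat phi [tuple x; y; z] <-> R x y z.

Definition definable3 (M : structure)
    (R : dom M -> dom M -> dom M -> Prop) : Prop :=
  exists phi : formula 3, defines3 phi R.

Definition Zmulle : structure :=
  @Structure int (fun x y => x * y) (fun x y => x <= y).

Definition succz (u : int) : int := u + 1.

Fixpoint shift (n : nat) (t : term n) : term n.+1 :=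
  match t with
  | Var i => Var (lift ord0 i)
  | Mul t1 t2 => Mul (shift t1) (shift t2)
  end.

Definition Lt (n : nat) (t u : term n) : formula n :=
  And (Le t u) (Not (Eq t u)).

Definition Iff (n : nat) (p q : formula n) : formula n :=
  And (Imp p q) (Imp q p).

(* S(t) = u, i.e. forall w, t < w <-> u <= w. *)
Definition IsSucc (n : nat) (t u : term n) : formula n :=
  All (Iff (Lt (shift t) (Var ord0)) (Le (shift u) (Var ord0))).

(* t = 0, the constant 0 being eliminated as the absorbing element. *)
Definition IsZero (n : nat) (t : term n) : formula n :=
  All (Eq (Mul (shift t) (Var ord0)) (shift t)).

Definition var (n k : nat) (kn : (k < n)%N) : term n := Var (Ordinal kn).

Definition succ_formula : formula 2 :=
  IsSucc (@var 2 0 isT) (@var 2 1 isT).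

(* S(x) * S(y) = S(x * y), unnested as
   exists a b, S(x) = a /\ S(y) = b /\ S(x * y) = a * b;
   the variables x, y, z, a, b are numbered 2, 3, 4, 1, 0. *)
Definition add_formula_zero : formula 3 :=
  let x := @var 5 2 isT in let y := @var 5 3 isT in
  let a := @var 5 1 isT in let b := @var 5 0 isT in
  Ex (Ex (And (IsSucc x a) (And (IsSucc y b) (IsSucc (Mul x y) (Mul a b))))).

(* S(z * x) * S(z * y) = S(z * z * S(x * y)), unnested as
   exists a b c, S(z * x) = a /\ S(z * y) = b /\ S(x * y) = c /\
                 S(z * z * c) = a * b;
   the variables x, y, z, a, b, c are numbered 3, 4, 5, 2, 1, 0. *)
Definition add_formula_nonzero : formula 3 :=
  let x := @var 6 3 isT in let y := @var 6 4 isT in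
  let z := @var 6 5 isT in
  let a := @var 6 2 isT in let b := @var 6 1 isT in
  let c := @var 6 0 isT in
  Ex (Ex (Ex (And (IsSucc (Mul z x) a) (And (IsSucc (Mul z y) b)
    (And (IsSucc (Mul x y) c) (IsSucc (Mul (Mul z z) c) (Mul a b))))))).

Definition add_formula : formula 3 :=
  let z := @var 3 2 isT in
  Or (And (IsZero z) add_formula_zero)
     (And (Not (IsZero z)) add_formula_nonzero).

(* Main.v *)
(** For [z = 0] the equation [S(x) S(y) = S(x y)] cancels to [x + y = 0]; for
    [z <> 0] the equation [S(zx) S(zy) = S(z z S(xy))] cancels to
    [z (x + y) = z z], and [z] may be simplified. *)
Require Import Defs.
From HB Require Import structures.
From mathcomp Require Import all_boot all_order all_algebra.
From mathcomp Require Import ring zify.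

Set Implicit Arguments.
Unset Strict Implicit.
Unset Printing Implicit Defensive.

Import Order.TTheory GRing.Theory Num.Theory.

Local Open Scope ring_scope.

(** Expanding the products reduces addition to multiplication and successor; dividing by [z] is what
    forces the separate case [z = 0]. It remains to express [S] and [0] in the language: over the
    integers, [S(u)] is the least strict upper bound of [u] ([succz_lt_iff]), and [0] is the only
    absorbing element ([sat_IsZero]). Satisfaction of [add_formula] then unfolds to the arithmetic
    condition of [addz_iff_succz_mul]. *)

Lemma eval_shift (M : structure) (n : nat) (v : n.-tuple (dom M)) (a : dom M)
    (t : term n) :
  eval [tuple of a :: v] (shift t) = eval v t.
Proof. by elim: t => [i|t1 IH1 t2 IH2] /=; rewrite ?tnthS ?IH1 ?IH2. Qed.

Lemma succz_lt_iff (u v : int) :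
  succz u = v <-> forall w : int, (u <= w /\ u <> w) <-> v <= w.
Proof.
rewrite /succz; split=> [<- w|Huv]; first by lia.
(* Taking [w = v] yields [u < v], so [u + 1 <= v]; taking [w = u + 1] yields [v <= u + 1]. *)
have := Huv v; have := Huv (u + 1); lia.
Qed.

Lemma sat_IsSucc (n : nat) (v : n.-tuple int) (t u : term n) :
  @sat Zmulle n (IsSucc t u) v <->
  succz (@eval Zmulle n v t) = @eval Zmulle n v u.
Proof.
rewrite succz_lt_iff.
have tail w := @eval_shift Zmulle n v w.
by split=> H w; move: (H w); rewrite /= !tail tnth0.
Qed.

Lemma sat_IsZero (n : nat) (v : n.-tuple int) (t : term n) :
  @sat Zmulle n (IsZero t) v <-> @eval Zmulle n v t = 0.
Proof.
have tail w := @eval_shift Zmulle n v w.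
split=> [H|H w]; last by rewrite /= tail H mul0r.
by move: (H 0); rewrite /= tail tnth0 mulr0 => <-.
Qed.

Lemma addz_iff_succz_mul (x y z : int) :
  x + y = z <->
  (z = 0 /\ succz x * succz y = succz (x * y)) \/
  (z <> 0 /\ succz (z * x) * succz (z * y) = succz (z * z * succz (x * y))).
Proof.
rewrite /succz; have [->|/eqP z0] := eqVneq z 0.
  by split=> [xy0|[[_]|[]//]]; [left; split=> //; lia | lia].
split=> [xyz|[[]//|[_ E]]]; first by right; split=> //; rewrite -xyz; ring.
(* After multiplication by [z], the goal is linear in the monomials of [E]. *)
by apply: (mulfI (introN eqP z0)); lia.
Qed.

(** Unnesting is harmless because successor is a total function: the quantified values exist and are
    forced. *)
Lemma sat_add_formula_zero (x y z : int) :
  @sat Zmulle 3 add_formula_zero [tuple x; y; z] <->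
  succz x * succz y = succz (x * y).
Proof.
split=> [[a [b [/sat_IsSucc xa [/sat_IsSucc yb /sat_IsSucc xyab]]]]|E].
  by move: xa yb xyab => /= <- <- ->.
by exists (succz x), (succz y); split; [|split]; apply/sat_IsSucc.
Qed.

Lemma sat_add_formula_nonzero (x y z : int) :
  @sat Zmulle 3 add_formula_nonzero [tuple x; y; z] <->
  succz (z * x) * succz (z * y) = succz (z * z * succz (x * y)).
Proof.
split=> [[a [b [c [/sat_IsSucc Ha [/sat_IsSucc Hb
          [/sat_IsSucc Hc /sat_IsSucc E]]]]]]|E].
  by move: Ha Hb Hc E => /= <- <- <- ->.
exists (succz (z * x)), (succz (z * y)), (succz (x * y)).
by split; [|split; [|split]]; apply/sat_IsSucc.
Qed.

Theorem mainTheorem1 :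
  let rhs (x y z : int) : Prop :=
    (z = 0 /\ succz x * succz y = succz (x * y)) \/
    (z <> 0 /\
     succz (z * x) * succz (z * y) = succz (z * z * succz (x * y))) in
  @definable3 Zmulle (fun x y z : int => x + y = z) /\
  (forall x y z : int, x + y = z <-> rhs x y z) /\
  @defines3 Zmulle add_formula rhs /\
  (forall u v : int,
     succz u = v <-> forall w : int, (u <= w /\ u <> w) <-> v <= w) /\
  @defines2 Zmulle succ_formula (fun u v : int => succz u = v).
Proof.
move=> rhs.
have add_formulaP : @defines3 Zmulle add_formula rhs.
  move=> x y z; have zP := sat_IsZero [tuple x; y; z] (@var 3 2 isT).
  have EP := sat_add_formula_zero x y z.
  have NP := sat_add_formula_nonzero x y z.
  by rewrite /rhs -EP -NP -zP.
split.
  by exists add_formula => x y z; rewrite add_formulaP addz_iff_succz_mul.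
split; first exact: addz_iff_succz_mul.
split=> //; split; first exact: succz_lt_iff.
by move=> u v; apply: sat_IsSucc.
Qed.
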